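(* Let $X$ be a Banach space and let $c>1$. Suppose that $(x_n)_{n\geq 1}$ is a sequence of vectors in $X$ satisfying $\|x_n\|\geq c^n$ for all $n\geq 1$. Then $0$ does not belong to the closure of the set $\{x_n : n\geq 1\}$ in the weak topology of $X$. *)

(* Defs.v *)
From mathcomp Require Import all_boot all_order all_algebra.
From mathcomp Require Import all_classical all_reals all_analysis.
Import Order.TTheory GRing.Theory Num.Theory.
Import numFieldNormedType.Exports.

Set Implicit Arguments.
Unset Strict Implicit.
Unset Printing Implicit Defensive.

Local Open Scope classical_set_scope.
Local Open Scope ring_scope.

(* Continuous linear functionals; [K^o] is [K] as a normed module over itself. *)
Definition topological_dual (K : numFieldType) (X : normedModType K) : Type :=
  {f : {linear X -> K^o} | continuous f}.

(* The coarsest topology on [X] making all elements of [topological_dual X] continuous. *)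
Definition weak_topology (K : numFieldType) (X : normedModType K) :
    topologicalType :=
  sup_topology (fun f : topological_dual X =>
    Topological.on (initial_topology (sval f : X -> K^o))).

(* Main.v *)
(** For a growth ratio of at least 4 a single functional works: if
    [4 ^ k <= |y k|], let [g k] be a norm-one functional norming [y k] and sum
    the series of [4 ^- k * g k], where the [k]-th term is kept only if the
    previous partial sum is too small at [y k]. Then the partial sum up to [k]
    is at least [4 ^- k * |y k| / 2] at [y k] in modulus, while the tail is at
    most [4 ^- k * |y k| / 3], so that the sum is bounded below by [1 / 6] on
    all the [y k]. For an arbitrary [c > 1], choose [N] with [4 <= c ^ N] and
    split the sequence into [N] subsequences according to the index modulo [N].

    The norming functionals come from the Hahn-Banach theorem, obtained by
    applying Zorn's lemma to sublinear functionals rather than to partially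
    defined linear ones: a minimal sublinear functional is linear. The complex
    case follows from the real one, since a real-linear [u] is the real part of
    the complex-linear [x |-> u x - i u (i x)]. *)
From HB Require Import structures.
Require Import Defs.
From mathcomp Require Import all_boot all_order all_algebra.
From mathcomp Require Import all_classical all_reals all_analysis.
From mathcomp Require Import complex.
From mathcomp Require Import ring lra.
Import Order.TTheory GRing.Theory Num.Theory.
Import numFieldNormedType.Exports.

Local Open Scope classical_set_scope.
Local Open Scope ring_scope.
Local Open Scope complex_scope.

(** * Sublinear functionals and the Hahn-Banach theorem *)

(* Homogeneity is only an inequality: applied to [a] and [a^-1] it is an
   equality, also at [0]. *)
Definition sublinear {R : realType} {V : lmodType R} (q : V -> R) : Prop :=
  (forall x y, q (x + y) <= q x + q y) /\
  (forall a x, 0 < a -> q (a *: x) <= a * q x).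

Lemma sublinear0 {R : realType} {V : lmodType R} (q : V -> R) :
  sublinear q -> q 0 = 0.
Proof.
move=> [qD qZ]; have := qD 0 0; rewrite addr0 => q0.
have := qZ 2^-1 0; rewrite scaler0 invr_gt0 ltr0n => /(_ isT) q0'.
by apply/eqP; rewrite eq_le; apply/andP; split; lra.
Qed.

Lemma sublinearZ {R : realType} {V : lmodType R} (q : V -> R) (a : R) (x : V) :
  sublinear q -> 0 <= a -> q (a *: x) = a * q x.
Proof.
move=> sq; rewrite le_eqVlt => /predU1P[<-|a0].
  by rewrite scale0r mul0r sublinear0.
apply/eqP; rewrite eq_le sq.2//= -ler_pdivlMl//.
rewrite -[in leLHS](scalerK (lt0r_neq0 a0) x).
by rewrite sq.2// invr_gt0.
Qed.

Lemma sublinear_ge {R : realType} {V : lmodType R} (q : V -> R) (x : V) :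
  sublinear q -> - q (- x) <= q x.
Proof.
by move=> sq; have := sq.1 x (- x); rewrite subrr sublinear0// -lerBlDr sub0r.
Qed.

Lemma odd_sublinear_scalar {R : realType} {V : lmodType R} (q : V -> R) :
  sublinear q -> (forall x, q (- x) <= - q x) -> scalar q.
Proof.
move=> sq qN'.
have qN x : q (- x) = - q x.
  by apply/eqP; rewrite eq_le qN'/= lerNl sublinear_ge.
have qD x y : q (x + y) = q x + q y.
  apply/eqP; rewrite eq_le sq.1/=.
  by have := sq.1 (- x) (- y); rewrite -opprD !qN -opprD lerN2.
move=> a x y; rewrite qD; congr (_ + _).
have [a0|/ltW a0] := leP 0 a; first exact: sublinearZ.
by rewrite -[a]opprK scaleNr qN sublinearZ ?oppr_ge0// !mulNr.
Qed.

Lemma minimal_sublinear {R : realType} {V : lmodType R} (p : V -> R) :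
  sublinear p -> exists q : V -> R, [/\ sublinear q, forall x, q x <= p x &
    forall q', sublinear q' -> (forall x, q' x <= q x) -> q' = q].
Proof.
move=> sp.
pose P (q : V -> R) := sublinear q /\ forall x, q x <= p x.
pose T := {q : V -> R | P q}.
(* The order is reversed: a maximal element for [le] is a minimal functional. *)
pose le (s t : T) := `[< forall x, sval t x <= sval s x >].
have [t|r s t /asboolP rs /asboolP st|s t /asboolP st /asboolP ts|A totA|q minq]
  := @Zorn T le.
- exact/asboolP.
- by apply/asboolP => x; exact: le_trans (rs x).
- case: s t st ts => s sP [t tP] /= st ts; apply: eq_exist; apply/funext => x.
  by apply/eqP; rewrite eq_le ts st.
- have [->|/set0P[r Ar]] := eqVneq A set0.
    by exists (exist P p (conj sp (fun x => lexx _))).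
  pose S x := [set sval q x | q in A].
  have S0 x : S x !=set0 by exists (sval r x); exists r.
  have Slb x : has_lbound (S x).
    (* [- p (- x) <= - q (- x) <= q x] for each [q] in the chain, so the infimum is finite. *)
    exists (- p (- x)) => _ [q Aq <-]; case: q Aq => q [sq qp] /= _.
    by apply: le_trans (sublinear_ge q x sq); rewrite lerN2.
  have infle q x : A q -> inf (S x) <= sval q x.
    by move=> Aq; apply: ge_inf => //; exists q.
  have sinf : sublinear (fun x => inf (S x)).
    split=> [x y|a x a0].
      rewrite -lerBlDr; apply: lb_le_inf => // _ [q Aq <-].
      rewrite lerBlDr -lerBlDl; apply: lb_le_inf => // _ [q' Aq' <-].
      rewrite lerBlDl.
      have [/asboolP qq'|/asboolP qq'] := totA _ _ Aq Aq'.
        apply: (le_trans (infle _ _ Aq')).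
        by apply: (le_trans ((svalP q').1.1 x y)); rewrite lerD2r.
      apply: (le_trans (infle _ _ Aq)).
      by apply: (le_trans ((svalP q).1.1 x y)); rewrite lerD2l.
    rewrite -ler_pdivrMl//; apply: lb_le_inf => // _ [q Aq <-].
    rewrite ler_pdivrMl//; apply: (le_trans (infle _ _ Aq)).
    exact: (svalP q).1.2.
  have infp x : inf (S x) <= p x.
    exact: le_trans (infle _ _ Ar) ((svalP r).2 x).
  exists (exist P _ (conj sinf infp)) => s As; apply/asboolP => x /=.
  exact: infle.
- exists (sval q); have [sq qp] := svalP q; split=> // q' sq' q'q.
  have q'p x : q' x <= p x by exact: le_trans (q'q x) (qp x).
  rewrite -(minq (exist P q' (conj sq' q'p)))//; exact/asboolP.
Qed.

(* [q'] is the infimum over [t >= 0] of [q (x + t *: y) - t * q y]; applied to a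
   minimal [q] it forces [q (- y) <= - q y], hence linearity. *)
Lemma sublinear_lower_at {R : realType} {V : lmodType R} (q : V -> R) (y : V) :
  sublinear q -> exists q' : V -> R, [/\ sublinear q', forall x, q' x <= q x &
    q' (- y) <= - q y].
Proof.
move=> sq.
pose S x := [set q (x + t *: y) - t * q y | t in [set t | 0 <= t]].
have S0 x : S x !=set0 by exists (q (x + 0 *: y) - 0 * q y); exists 0 => /=.
have Slb x : has_lbound (S x).
  (* [t * q y = q (t *: y) <= q (x + t *: y) + q (- x)]. *)
  exists (- q (- x)) => _ [t /= t0 <-]; rewrite -(sublinearZ _ _ _ sq)//.
  have := sq.1 (x + t *: y) (- x); rewrite addrC addKr => h; lra.
have infle x t : 0 <= t -> inf (S x) <= q (x + t *: y) - t * q y.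
  by move=> t0; apply: ge_inf => //; exists t.
exists (fun x => inf (S x)); split.
- split=> [x x'|a x a0].
    rewrite -lerBlDr; apply: lb_le_inf => // _ [t /= t0 <-].
    rewrite lerBlDr -lerBlDl; apply: lb_le_inf => // _ [t' /= t'0 <-].
    have := infle (x + x') (t + t') (addr_ge0 t0 t'0).
    have := sq.1 (x + t *: y) (x' + t' *: y).
    rewrite addrACA -scalerDl mulrDl; lra.
  rewrite -ler_pdivrMl//; apply: lb_le_inf => // _ [t /= t0 <-].
  rewrite ler_pdivrMl//; apply: (le_trans (infle _ (a * t) _)).
    by rewrite mulr_ge0// ltW.
  by rewrite -scalerA -scalerDr mulrBr mulrA lerD2r sq.2.
- by move=> x; have := infle x 0 (lexx _); rewrite scale0r mul0r addr0 subr0.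
- by have := infle (- y) 1 ler01; rewrite scale1r mul1r addNr sublinear0// sub0r.
Qed.

(** Lowering [p] at [y] before minimizing gives [f (- y) <= - p y], which for linear [f] is
    [p y <= f y]. *)
Lemma hahn_banach_at {R : realType} {V : lmodType R} (p : V -> R) (y : V) :
  sublinear p -> exists f : V -> R,
    [/\ scalar f, forall x, f x <= p x & f y = p y].
Proof.
move=> sp; have [q [sq qp qNy]] := sublinear_lower_at p y sp.
have [f [sf fq minf]] := minimal_sublinear q sq.
(* By minimality, lowering [f] at [x] returns [f] itself. *)
have fN x : f (- x) <= - f x.
  have [f' [sf' f'f f'x]] := sublinear_lower_at f x sf.
  by rewrite -[X in X (- x)](minf f').
have lf := odd_sublinear_scalar f sf fN.
exists f; split=> [//|x|]; first exact: le_trans (fq x) (qp x).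
apply/eqP; rewrite eq_le (le_trans (fq y) (qp y))/=.
rewrite -lerN2; apply: le_trans qNy; apply: le_trans (fq _).
by have := sublinear_ge f (- y) sf; rewrite opprK lerNl.
Qed.

(** * Lower bounds along a fast-growing sequence *)

Definition seminorm {R : realType} {V : lmodType R} (p : V -> R) : Prop :=
  (forall x y, p (x + y) <= p x + p y) /\
  (forall a x, p (a *: x) = `|a| * p x).

Lemma seminorm_functional {R : realType} {V : lmodType R} (p : V -> R) (y : V) :
  seminorm p -> exists f : V -> R,
    [/\ scalar f, forall x, `|f x| <= p x & f y = p y].
Proof.
move=> [pD pZ].
have [|f [lf fp fy]] := hahn_banach_at p y.
  by split=> // a x a0; rewrite pZ gtr0_norm.
exists f; split=> // x; rewrite ler_norml fp andbT lerNl.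
have fN : f (- x) = - f x.
  have f0 : f 0 = 0 by have := lf (-1) 0 0; rewrite scaler0 addr0; lra.
  by have := lf (-1) x 0; rewrite scaleN1r !addr0 f0 mulN1r addr0.
by rewrite -fN (le_trans (fp _))// -scaleN1r pZ normrN1 mul1r.
Qed.

Lemma seminorm_ge0 {R : realType} {V : lmodType R} (p : V -> R) (x : V) :
  seminorm p -> 0 <= p x.
Proof.
move=> [pD pZ]; have := pD x (- x).
rewrite subrr -{1}(scale0r x) -scaleN1r !pZ normrN1 normr0; lra.
Qed.

(** A seminorm on a real vector space covers the real part of a complex norm as well. The constant
    [4 / 3] is the sum of the [4 ^- k]. *)
Lemma seminorm_functional_seq {R : realType} {V : lmodType R} (p : V -> R)
    (y : nat -> V) :
  seminorm p -> (forall k, 4 ^+ k <= p (y k)) ->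
  exists f : V -> R, [/\ scalar f, forall x, `|f x| <= 4 / 3 * p x &
    forall k, 6^-1 <= `|f (y k)|].
Proof.
move=> np py.
have p0 x : 0 <= p x by exact: seminorm_ge0.
have /choice [g gP] : forall k, exists g : V -> R,
    [/\ scalar g, forall x, `|g x| <= p x & g (y k) = p (y k)].
  by move=> k; exact: seminorm_functional.
pose b k : R := 4^-1 ^+ k.
have b0 k : 0 < b k by rewrite exprn_gt0.
have bS k : b k.+1 = b k / 4 by rewrite /b exprSr.
(* [F k] sums the terms of index below [k], so the choice made for [y k] first shows in [F k.+1]. *)
pose F := fix F k x := if k is k'.+1 then
  F k' x + (if `|F k' (y k')| < b k' * p (y k') / 2 then b k' * g k' x else 0)
  else 0.
have FS k x : F k.+1 x = F k x +
  (if `|F k (y k)| < b k * p (y k) / 2 then b k * g k x else 0) by [].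
have sF k : scalar (F k).
  elim: k => [|k IH] a u v; first by rewrite /F mulr0 addr0.
  rewrite !FS IH; case: ifP => _; last by ring.
  by have [-> _ _] := gP k; ring.
have dF k x : `|F k.+1 x - F k x| <= b k * p x.
  rewrite FS addrC addKr; case: ifP => _; last first.
    by rewrite normr0 mulr_ge0// ltW.
  by have [_ gp _] := gP k; rewrite normrM gtr0_norm// ler_pM2l.
(* [4 / 3 * (b k - b (k + m))] is the exact geometric sum, which lets the induction close by linear
   arithmetic. *)
have tF k m x : `|F (k + m)%N x - F k x| <= 4 / 3 * (b k - b (k + m)%N) * p x.
  elim: m => [|m IH]; first by rewrite addn0 !subrr normr0 mulr0 mul0r.
  rewrite addnS; have := dF (k + m)%N x; rewrite bS => d.
  have := ler_distD (F (k + m)%N x) (F (k + m).+1 x) (F k x); lra.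
have Fcvg x : cvgn (fun k => F k x).
  have -> : (fun k => F k x) = series (fun k => F k.+1 x - F k x).
    by apply/funext => n; rewrite /series/= telescope_sumr// subr0.
  apply: normed_cvg; apply: series_le_cvg (dF ^~ x) _ => //.
    by move=> n; rewrite mulr_ge0// ltW.
  have -> : (fun k => b k * p x) = geometric (p x) 4^-1.
    by apply/funext => k; rewrite /= mulrC.
  by apply: is_cvg_geometric_series; rewrite gtr0_norm//; lra.
pose G x := limn (fun k => F k x).
have GF k x : `|G x - F k x| <= 4 / 3 * b k * p x.
  have h : (fun n => `|F n x - F k x|) @ \oo --> `|G x - F k x|.
    by apply: cvg_norm; apply: cvgB; [exact: Fcvg|exact: cvg_cst].
  rewrite -(cvg_lim _ h)//; apply: limr_le; first exact: cvgP h.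
  near=> n; have kn : (k <= n)%N by near: n; exact: nbhs_infty_ge.
  have := tF k (n - k)%N x; rewrite subnKC// => /le_trans; apply.
  rewrite ler_wpM2r// ler_wpM2l//.
  by have := b0 n; lra.
exists G; split.
- move=> a u v; apply/cvg_lim => //.
  rewrite (_ : (fun k => _) = (fun k => a * F k u + F k v)); last first.
    by apply/funext => k; exact: sF.
  by apply: cvgD; [apply: cvgM; [exact: cvg_cst|]|]; exact: Fcvg.
- by move=> x; have := GF 0%N x; rewrite subr0 /b expr0 mulr1.
- move=> k.
  (* A kept term has value [b k * p (y k)] and meets a partial sum below half of that; a term is
     dropped only when the partial sum is already large enough. *)
  have hF : b k * p (y k) / 2 <= `|F k.+1 (y k)|.
    rewrite FS; case: ifP => [hF|/negbT]; last by rewrite -leNgt addr0.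
    have [_ _ ->] := gP k.
    have bp0 : 0 <= b k * p (y k) by rewrite mulr_ge0// ltW.
    have := lerB_normD (b k * p (y k)) (F k (y k)).
    by rewrite [F k _ + _]addrC ger0_norm//; lra.
  have bp : 1 <= b k * p (y k).
    by rewrite /b exprVn -ler_pdivrMl ?invr_gt0 ?exprn_gt0// invrK mulr1.
  (* The tail is at most [4 / 3 * b k.+1 = b k / 3] times [p (y k)], and [1 / 2 - 1 / 3 = 1 / 6]. *)
  have := GF k.+1 (y k); rewrite bS => hG.
  have := ler_distD (G (y k)) 0 (F k.+1 (y k)).
  rewrite !sub0r !normrN; lra.
Unshelve. all: by end_near.
Qed.

(** * Weak neighbourhoods of the origin *)

Lemma nbhs_weak0 {K : numFieldType} {X : normedModType K}
    (f : topological_dual X) (d : K) :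
  0 < d -> nbhs (0 : weak_topology X) [set x | `|sval f x| < d].
Proof.
move=> d0.
have /cvg_sup/(_ f) h : (nbhs (0 : weak_topology X)) --> (0 : weak_topology X).
  exact: cvg_id.
apply: h.
have : {for 0, continuous (sval f : initial_topology (sval f : X -> K^o) -> K^o)}.
  exact: initial_continuous.
rewrite /prop_for /continuous_at linear0 => /cvgr0_norm_lt; exact.
Qed.

(** A finite intersection of the sets [|f i x| < d] is a weak neighbourhood of [0] that misses
    [A]. *)
Lemma not_weak_closure0 {K : numFieldType} {X : normedModType K} {A : set X}
    {I : finType} (f : I -> topological_dual X) (d : K) :
  0 < d -> (forall x, A x -> exists i, d <= `|sval (f i) x|) ->
  ~ @closure (weak_topology X) A (0 : X).
Proof.
move=> d0 Af clA.
have : nbhs (0 : weak_topology X) [set x | forall i, `|sval (f i) x| < d].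
  refine (@filter_forall (weak_topology X) I (fun i x => `|sval (f i) x| < d)
    (nbhs (0 : weak_topology X)) _ _).
  by move=> i; exact: nbhs_weak0.
move=> /clA[x [Ax fx]].
have [j] := Af _ Ax.
(* The order of [K] is partial; both sides are real, hence comparable. *)
by rewrite real_leNgt ?realE ?(ltW d0) ?normr_ge0// (fx j).
Qed.

(** * Splitting the sequence modulo [N] *)

(** Shared by real and complex scalars: the third hypothesis is what each field has to supply. *)
Lemma not_weak_closure0_seq {K : numFieldType} {X : normedModType K}
    (x : nat -> X) (N : nat) (d : K) : 0 < d -> (0 < N)%N ->
  (forall y : nat -> X, (forall k, 4 ^+ k <= `|y k|) ->
    exists f : topological_dual X, forall k, d <= `|sval f (y k)|) ->
  (forall r k, 4 ^+ k <= `|x (k * N + r).+1|) ->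
  ~ @closure (weak_topology X)
      [set x n | n in [set n : nat | (1 <= n)%N]] (0 : X).
Proof.
move=> d0 N0 dual xN.
have /choice[f fP] : forall r : 'I_N, exists f : topological_dual X,
    forall k, d <= `|sval f (x (k * N + r).+1)|.
  by move=> r; apply: dual => k; exact: xN.
apply: (not_weak_closure0 f d d0) => _ [[//|n] _ <-].
(* Indices start at 1, so the class of [n.+1] is read off from [n]. *)
exists (Ordinal (ltn_pmod n N0)).
by rewrite [in leRHS](congr1 S (divn_eq n N)); exact: fP.
Qed.

(** [c^-1 ^+ N] tends to [0], so it is eventually at most [4^-1]. *)
Lemma exp_ge4 {R : realType} (c : R) : 1 < c ->
  exists2 N, (0 < N)%N & 4 <= c ^+ N.
Proof.
move=> c1.
have /cvg_expr/cvgr0_norm_le : `|c^-1| < 1.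
  by rewrite gtr0_norm ?invr_gt0 ?invf_lt1// (lt_trans ltr01).
move=> /(_ 4^-1 ltac:(by rewrite invr_gt0)) h.
near \oo => N; exists N; first by near: N; exact: nbhs_infty_gt.
have : `|c^-1 ^+ N| <= 4^-1 by near: N.
rewrite exprVn normfV ger0_norm ?exprn_ge0 ?(le_trans ler01 (ltW c1))//.
by rewrite lef_pV2 ?posrE ?exprn_gt0// (lt_trans ltr01 c1).
Unshelve. all: by end_near. Qed.

Lemma exp_mulnD_ge {R : realType} (c : R) (N k r : nat) :
  1 <= c -> 4 <= c ^+ N -> 4 ^+ k <= c ^+ (k * N + r).+1.
Proof.
move=> c1 cN; rewrite -addnS exprD mulnC exprM.
rewrite -[leLHS]mulr1 ler_pM ?exprn_ge0 ?exprn_ege1//.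
by rewrite lerXn2r ?nnegrE// (le_trans _ cN).
Qed.

(** * Real scalars *)

Lemma seminorm_norm {R : realType} (X : normedModType R) :
  seminorm (fun x : X => `|x|).
Proof. by split; [exact: ler_normD|exact: normrZ]. Qed.

Lemma real_dual {R : realType} {X : normedModType R} (y : nat -> X) :
  (forall k, 4 ^+ k <= `|y k|) ->
  exists f : topological_dual X, forall k, 6^-1 <= `|sval f (y k)|.
Proof.
move=> yk.
have [f [lf fle fge]] := seminorm_functional_seq _ _ (seminorm_norm X) yk.
pose Lf := GRing.isLinear.Build R X R^o *:%R f lf.
pose g : {linear X -> R^o} := HB.pack f Lf.
have gc : continuous g.
  apply: bounded_linear_continuous; apply/linear_boundedP.
  exists (4 / 3); split=> [|r /ltW r43 x]; first exact: num_real.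
  by apply: (le_trans (fle x)); rewrite ler_wpM2r.
by exists (exist _ g gc).
Qed.

(** * Complex scalars *)

(** An alias of [X] that carries the real scalar multiplication beside the complex one. *)
Definition realification {R : realType} (X : lmodType R[i]) : Type := X.

Section Realification.
Variables (R : realType) (X : lmodType R[i]).

HB.instance Definition _ := GRing.Zmodule.on (realification X).

Definition real_scale (a : R) (x : realification X) : realification X :=
  a%:C *: (x : X).

Fact real_scaleA a b x : real_scale a (real_scale b x) = real_scale (a * b) x.
Proof. by rewrite /real_scale scalerA -rmorphM. Qed.

Fact real_scale1 : left_id 1 real_scale.
Proof. by move=> x; rewrite /real_scale scale1r. Qed.

Fact real_scaleDr : right_distributive real_scale +%R.
Proof. by move=> a x y; rewrite /real_scale scalerDr. Qed.

Fact real_scaleDl x : {morph real_scale^~ x : a b / a + b}.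
Proof. by move=> a b; rewrite /real_scale rmorphD scalerDl. Qed.

HB.instance Definition _ := GRing.Zmodule_isLmodule.Build R (realification X)
  real_scaleA real_scale1 real_scaleDr real_scaleDl.

End Realification.

(** The norm of a complex normed module takes values in [R[i]]; its real part serves as the
    real-valued norm. *)
Lemma complex_normE {R : realType} {X : normedModType R[i]} (x : X) :
  `|x| = (complex.Re `|x|)%:C.
Proof. by rewrite RRe_real// ger0_real. Qed.

Lemma norm_realC {R : realType} (a : R) : `|a%:C| = `|a|%:C.
Proof. by rewrite normc_def/= expr0n addr0 sqrtr_sqr. Qed.

Lemma seminorm_Re_norm {R : realType} (X : normedModType R[i]) :
  seminorm (fun x : realification X => complex.Re `|x : X|).
Proof.
split=> [x y|a x].
  by rewrite -lecR rmorphD/= -!complex_normE ler_normD.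
apply: complexI; rewrite rmorphM/= -!complex_normE normrZ.
by rewrite norm_realC.
Qed.

Lemma complex_dual {R : realType} {X : normedModType R[i]} (y : nat -> X) :
  (forall k, 4 ^+ k <= `|y k|) ->
  exists f : topological_dual X, forall k, (6^-1 : R[i]) <= `|sval f (y k)|.
Proof.
move=> yk.
have [k|u [lu ule uge]] :=
  @seminorm_functional_seq R (realification X) _ y (seminorm_Re_norm X).
  by rewrite -lecR rmorphXn/= -complex_normE (_ : 4%:C = 4) ?rmorph_nat.
pose f (x : X) : R[i]^o := (u x) -i* (u ('i *: x)).
have u0 : u 0 = 0 by have := lu (-1) 0 0; rewrite scaler0 addr0; lra.
have uD (v w : X) : u (v + w) = u v + u w.
  by have := lu 1 v w; rewrite scale1r mul1r.
have uZ (a : R) (v : X) : u (a%:C *: v) = a * u v.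
  by have := lu a v 0; rewrite !addr0 u0 addr0.
have lf : linear f.
  move=> a v w; rewrite /f scalerDr !uD scalerA mulrC -scalerA.
  (* This formula reduces complex linearity of [f] to [i ^ 2 = -1] and ring identities. *)
  have uC z : u (a *: z) = complex.Re a * u z + complex.Im a * u ('i *: z).
    rewrite [in LHS](complexE a) scalerDl uD uZ; congr (_ + _).
    by rewrite mulrC -scalerA uZ.
  rewrite !uC scalerA -expr2 sqr_i scaleN1r.
  have -> : u (- v) = - u v.
    by rewrite -scaleN1r; have := uZ (-1) v; rewrite rmorphN1 mulN1r.
  rewrite /GRing.scale/=; case: a {uC} => ar ai /=; simpc.
  by congr (_ +i* _); ring.
pose Lf := GRing.isLinear.Build R[i] X R[i]^o *:%R f lf.
pose g : {linear X -> R[i]^o} := HB.pack f Lf.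
have gc : continuous g.
  apply: bounded_linear_continuous; apply/linear_boundedP.
  (* One [4 / 3] for each of the two terms of [f x], since multiplication by [i] preserves the
     norm. *)
  exists (4 / 3 + 4 / 3); split=> [|r /ltW r83 x]; first by rewrite ger0_real.
  apply: (@le_trans _ _ ((4 / 3 + 4 / 3) * `|x|)); last by rewrite ler_wpM2r.
  have normi : `|'i%C : R[i]| = 1.
    by rewrite normc_def/= expr0n expr1n add0r sqrtr1.
  have uC (z : X) : `|(u z)%:C| <= 4 / 3 * `|z|.
    rewrite norm_realC complex_normE.
    have -> : 4 / 3 = (4 / 3)%:C :> R[i] by rewrite fmorph_div/= !rmorph_nat.
    by rewrite -rmorphM lecR ule.
  have fE : f x = (u x)%:C - 'i%C * (u ('i%C *: x))%:C by rewrite /f; simpc.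
  rewrite [g x]fE.
  apply: le_trans (ler_normB _ _) _; rewrite normrM normi mul1r.
  have := lerD (uC x) (uC ('i%C *: x)); rewrite normrZ normi mul1r.
  by rewrite -mulrDl.
exists (exist _ g gc) => k /=.
(* The real part of [f (y k)] is [u (y k)], so the lower bound for [u] carries over. *)
apply: le_trans (normc_ge_Re _) => /=.
by rewrite (_ : 6^-1 = (6^-1)%:C) ?lecR// rmorphV/= ?rmorph_nat ?unitfE.
Qed.

Theorem lemma1 (R : realType) (c : R) (hc : 1 < c) :
  (forall (X : completeNormedModType R) (x : nat -> X),
      (forall n : nat, (1 <= n)%N -> c ^+ n <= `|x n|) ->
      ~ @closure (weak_topology X)
          [set x n | n in [set n : nat | (1 <= n)%N]] (0 : X))
  /\
  (forall (X : completeNormedModType R[i]) (x : nat -> X),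
      (forall n : nat, (1 <= n)%N -> (c ^+ n)%:C <= `|x n|) ->
      ~ @closure (weak_topology X)
          [set x n | n in [set n : nat | (1 <= n)%N]] (0 : X)).
Proof.
have [N N0 cN] := exp_ge4 c hc.
split=> X x xc.
- apply: (not_weak_closure0_seq x N 6^-1) => //; first exact: real_dual.
  by move=> r k; apply: le_trans (xc _ _) => //; exact: exp_mulnD_ge (ltW hc) cN.
- apply: (not_weak_closure0_seq x N 6^-1) => //; first exact: complex_dual.
  move=> r k; apply: le_trans (xc _ _) => //.
  have := exp_mulnD_ge c N k r (ltW hc) cN.
  by rewrite -lecR rmorphXn/= rmorph_nat.
Qed.
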